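(* Let $H\in(0,1)$, let $(a,b)\in\mathbb{R}^2\setminus\{(0,0)\}$, and let $(Z_t^H(a,b))_{t\ge 0}$ be the generalized fractional Brownian motion with parameters $a,b,H$. For all $(s,t)\in\mathbb{R}_+^2$ such that $s\le t$: (1) $$E\bigl(Z_t^H(a,b)-Z_s^H(a,b)\bigr)^2=(a^2+b^2)|t-s|^{2H}-2^{2H}ab\bigl(|t|^{2H}+|s|^{2H}\bigr)+2ab\,|t+s|^{2H};$$ (2) $$\gamma(a,b,H)\,(t-s)^{2H}\le E\bigl(Z_t^H(a,b)-Z_s^H(a,b)\bigr)^2\le \nu(a,b,H)\,(t-s)^{2H},$$ where $$\gamma(a,b,H)=\bigl(a^2+b^2-2ab(2^{2H-1}-1)\bigr)\mathbf{1}_{\mathcal{C}}(a,b,H)+\bigl(a^2+b^2\bigr)\mathbf{1}_{\mathcal{D}}(a,b,H)$$ and $$\nu(a,b,H)=\bigl(a^2+b^2\bigr)\mathbf{1}_{\mathcal{C}}(a,b,H)+\bigl(a^2+b^2-2ab(2^{2H-1}-1)\bigr)\mathbf{1}_{\mathcal{D}}(a,b,H).$$ Moreover, the constants in the inequalities of (2) are the best possible.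
   Context: For $H\in(0,1)$, a two-sided fractional Brownian motion with Hurst parameter $H$ is a centered Gaussian process $B^H=(B_t^H)_{t\in\mathbb{R}}$ on a probability space $(\Omega,F,\mathbb{P})$ with covariance $\operatorname{Cov}(B_t^H,B_s^H)=\frac12\bigl(|s|^{2H}+|t|^{2H}-|t-s|^{2H}\bigr)$ for $s,t\in\mathbb{R}$. For real $a,b$ with $(a,b)\ne(0,0)$, the generalized fractional Brownian motion (gfBm) with parameters $a,b,H$ is the process $Z^H=(Z_t^H)_{t\ge0}$ defined by $Z_t^H=Z_t^H(a,b)=aB_t^H+bB_{-t}^H$ for $t\ge 0$. Here $E$ denotes expectation, $\mathbf{1}_A$ denotes the indicator function of a set $A$, and the sets $\mathcal{C}$ and $\mathcal{D}$ are $$\mathcal{C}=\bigl\{(a,b,H)\in(\mathbb{R}^2\setminus\{(0,0)\})\times(0,1):\ (H>\tfrac12,\ ab\ge0)\text{ or }(H<\tfrac12,\ ab\le0)\bigr\},$$ $$\mathcal{D}=\bigl\{(a,b,H)\in(\mathbb{R}^2\setminus\{(0,0)\})\times(0,1):\ (H>\tfrac12,\ ab\le0)\text{ or }(H<\tfrac12,\ ab\ge0)\bigr\}.$$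
   Formalization: If H = 1/2 (in neither C nor D) or ab = 0, H ≠ 1/2 (in both), the literal γ and ν equal 0 or 2(a²+b²) and (2) fails; there (2) and its optimality are stated with a²+b² for both constants. Otherwise γ and ν are literal; (1) is unchanged. *)

(* Defs.v *)
(* MathComp-Analysis, over an arbitrary [R : realType]. *)
From HB Require Import structures.
From mathcomp Require Import all_boot all_order all_algebra.
From mathcomp Require Import all_classical all_reals all_analysis.
Set Implicit Arguments.
Unset Strict Implicit.
Unset Printing Implicit Defensive.
Import Order.TTheory GRing.Theory Num.Theory.
Import numFieldNormedType.Exports.
Local Open Scope classical_set_scope.
Local Open Scope ring_scope.

(* Degenerate (constant) variables count as Gaussian.  The Dirac case is
   separate because [normal_prob m 0] is not the point mass at [m]. *)
Definition gaussian_rv d (T : measurableType d) (R : realType)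
    (P : probability T R) (X : {RV P >-> R}) : Prop :=
  exists m : R,
    (forall A : set R, measurable A -> distribution P X A = \d_m A) \/
    (exists2 sigma : R, 0 < sigma &
      forall A : set R, measurable A ->
        distribution P X A = normal_prob m sigma A).

(* All finite-dimensional marginals are (possibly degenerate) Gaussian vectors,
   i.e. all finite linear combinations of the process are Gaussian. *)
Definition gaussian_process d (T : measurableType d) (R : realType)
    (P : probability T R) (I : Type) (X : I -> {RV P >-> R}) : Prop :=
  forall (n : nat) (t : 'I_n -> I) (c : 'I_n -> R),
    gaussian_rv (\sum_(i < n) c i *: X (t i) : {RV P >-> R}).

Definition two_sided_fBm d (T : measurableType d) (R : realType)
    (P : probability T R) (H : R) (B : R -> {RV P >-> R}) : Prop :=
  [/\ gaussian_process B,
      forall t : R, 'E_P[B t]%E = 0%E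
    & forall t s : R, covariance P (B t) (B s) =
        (2^-1 * (`|s| `^ (2 * H) + `|t| `^ (2 * H) - `|t - s| `^ (2 * H)))%:E].

(* The process is meant for times [0 <= t] only. *)
Definition gfBm d (T : measurableType d) (R : realType)
    (P : probability T R) (a b : R) (B : R -> {RV P >-> R}) (t : R) :
    {RV P >-> R} :=
  a *: B t + b *: B (- t).

Definition setC_gfBm (R : realType) : set (R * R * R) :=
  [set p | let: (a, b, H) := p in
     [/\ (a, b) != (0, 0), 0 < H < 1
       & (2^-1 < H /\ 0 <= a * b) \/ (H < 2^-1 /\ a * b <= 0)]].

Definition setD_gfBm (R : realType) : set (R * R * R) :=
  [set p | let: (a, b, H) := p in
     [/\ (a, b) != (0, 0), 0 < H < 1
       & (2^-1 < H /\ a * b <= 0) \/ (H < 2^-1 /\ 0 <= a * b)]].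

(* The two sets overlap when [a * b = 0] and both miss [H = 2^-1]; there the
   indicator formulas below give [2 * (a ^+ 2 + b ^+ 2)] (resp. [0]), although
   the two branches both equal [a ^+ 2 + b ^+ 2]. *)
Definition gamma_gfBm (R : realType) (a b H : R) : R :=
  (a ^+ 2 + b ^+ 2 - 2 * a * b * (2 `^ (2 * H - 1) - 1))
    * \1_(@setC_gfBm R) (a, b, H)
  + (a ^+ 2 + b ^+ 2) * \1_(@setD_gfBm R) (a, b, H).

Definition nu_gfBm (R : realType) (a b H : R) : R :=
  (a ^+ 2 + b ^+ 2) * \1_(@setC_gfBm R) (a, b, H)
  + (a ^+ 2 + b ^+ 2 - 2 * a * b * (2 `^ (2 * H - 1) - 1))
    * \1_(@setD_gfBm R) (a, b, H).

Definition incr_lower_bound d (T : measurableType d) (R : realType)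
    (P : probability T R) (Z : R -> {RV P >-> R}) (H c : R) : Prop :=
  forall s t : R, 0 <= s -> s <= t ->
    ((c * (t - s) `^ (2 * H))%:E <= 'E_P[fun w => ((Z t w - Z s w) ^+ 2)%R])%E.

Definition incr_upper_bound d (T : measurableType d) (R : realType)
    (P : probability T R) (Z : R -> {RV P >-> R}) (H c : R) : Prop :=
  forall s t : R, 0 <= s -> s <= t ->
    ('E_P[fun w => ((Z t w - Z s w) ^+ 2)%R] <= (c * (t - s) `^ (2 * H))%:E)%E.

Definition best_incr_bounds d (T : measurableType d) (R : realType)
    (P : probability T R) (Z : R -> {RV P >-> R}) (H g n : R) : Prop :=
  [/\ incr_lower_bound Z H g,
      incr_upper_bound Z H n,
      forall c : R, incr_lower_bound Z H c -> c <= g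
    & forall c : R, incr_upper_bound Z H c -> n <= c].

(* Main.v *)
(* Put p = 2H, k = ab, u = t + s and v = t - s.  The increment variance is
   (a^2 + b^2) v^p - k u^p (S(v/u) - 2) with S(x) = (1+x)^p + (1-x)^p.
   Everything follows from one estimate: if k (p - 1) >= 0 then, on [0, 1],
   0 <= k (S(x) - 2) <= x^2 k (2^p - 2).
   Since x^2 <= x^p, the subtracted term lies between 0 and k (2^p - 2) v^p; the
   upper value is attained at (s, t) = (0, 1), and the lower one is optimal
   because x^2 = o(x^p) as x -> 0.  The case k (p - 1) <= 0 is obtained by
   replacing k by -k. *)
Require Import Defs.
From HB Require Import structures.
From mathcomp Require Import all_boot all_order all_algebra.
From mathcomp Require Import all_classical all_reals all_analysis.
From mathcomp Require Import ring lra.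
Set Implicit Arguments.
Unset Strict Implicit.
Unset Printing Implicit Defensive.
Import Order.TTheory GRing.Theory Num.Theory.
Import numFieldNormedType.Exports.
Local Open Scope classical_set_scope.
Local Open Scope ring_scope.

(** * Convexity-type estimates for the symmetric power sum *)

(** The interval excludes 1 because [(1 - x) ^ p] need not be differentiable there. *)
Lemma is_derive_ge0_homo (R : realType) (f df : R -> R) :
  (forall x : R, 0 <= x < 1 -> is_derive x 1 f (df x)) ->
  (forall x : R, 0 <= x < 1 -> 0 <= df x) ->
  forall x y : R, 0 <= x -> x <= y -> y < 1 -> f x <= f y.
Proof.
move=> fdf df0 x y x0 xy y1.
have io (z : R) : z \in `]0, 1[%R -> 0 <= z < 1.
  by rewrite in_itv/= => /andP[/ltW -> ->].
apply: (@ger0_derive1_le_co R f 0 1); rewrite ?in_itv/= ?x0 ?(le_lt_trans xy)//.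
- by move=> z /io/fdf [].
- move=> z /io z01.
  by rewrite derive1E (@derive_val _ _ _ _ _ _ _ (fdf z z01)) df0.
- by apply: derivable_within_continuous => z; rewrite in_itv/= => /fdf; case.
- by rewrite y1 (le_trans x0).
Qed.

(** The overview's S is the case [e = 1]. The coefficient [e] makes the family closed under
    differentiation, which flips its sign and lowers [p] by one. *)
Definition powR_sym (R : realType) (p e x : R) : R :=
  (1 + x) `^ p + e * (1 - x) `^ p.

Lemma is_derive_powR_sym (R : realType) (p e l x : R) :
  0 <= l <= 1 -> 0 <= x < 1 ->
  is_derive x 1 (fun x => powR_sym p e (l * x))
    (l * p * powR_sym (p - 1) (- e) (l * x)).
Proof.
move=> /andP[l0 l1] /andP[x0 x1].
have lx0 : 0 <= l * x by rewrite mulr_ge0.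
have lx1 : l * x < 1 by rewrite (le_lt_trans _ x1)// ler_piMl.
have h1 : 0 < 1 + l * x by lra.
have h2 : 0 < 1 - l * x by lra.
have d1 := @is_derive1_powR R p _ h1.
have d2 := @is_derive1_powR R p _ h2.
have D1 : is_derive x 1 (fun x : R => (1 + l * x)) l.
  by apply: is_derive_eq; rewrite /GRing.scale/=; ring.
have D2 : is_derive x 1 (fun x : R => (1 - l * x)) (- l).
  by apply: is_derive_eq; rewrite /GRing.scale/=; ring.
have E1 := @is_derive1_comp _ (@powR R ^~ p)
  (fun x : R => 1 + l * x) x _ _ d1 D1.
have E2 := @is_derive1_comp _ (@powR R ^~ p)
  (fun x : R => 1 - l * x) x _ _ d2 D2.
rewrite /powR_sym.
apply: (is_derive_eq (is_deriveD E1 (is_deriveZ e E2))).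
by rewrite /GRing.scale/=; ring.
Qed.

Lemma powR_sym_le0 (R : realType) (r x : R) :
  r <= 0 -> 0 <= x < 1 -> powR_sym r (-1) x <= 0.
Proof.
move=> r0 /andP[x0 x1]; rewrite /powR_sym mulN1r subr_le0.
rewrite -[r]opprK !(powRN _ (- r)) lef_pV2 ?posrE ?powR_gt0; try lra.
by apply: ge0_ler_powR; rewrite ?nnegrE; lra.
Qed.

(** The derivative is [r] times (1 + x)^(r - 1) - (1 - x)^(r - 1), a product of two nonpositive
    factors. *)
Lemma powR_sym_homo (R : realType) (r x y : R) :
  r <= 0 -> 0 <= x -> x <= y -> y < 1 -> powR_sym r 1 x <= powR_sym r 1 y.
Proof.
move=> r0 x0 xy y1; have l1 : 0 <= (1 : R) <= 1 by rewrite ler01 /=.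
have := is_derive_ge0_homo
  (fun z z01 => is_derive_powR_sym r 1 l1 z01) _ x0 xy y1.
rewrite !mul1r; apply => z z01; rewrite !mul1r; apply: mulr_le0 => //.
by apply: powR_sym_le0 => //; lra.
Qed.

Lemma powR_sym0 (R : realType) (r e : R) : powR_sym r e 0 = 1 + e.
Proof. by rewrite /powR_sym addr0 subr0 powR1 mulr1. Qed.

(** This prepares the upper half of the quadratic estimate: [l] becomes its argument, and letting
    [x] tend to 1 turns S(x) into 2^p. Keeping [x < 1] avoids differentiating at the endpoint. *)
Lemma powR_sym_scale (R : realType) (p k l x : R) :
  0 < p < 2 -> 0 <= k * (p - 1) -> 0 <= l <= 1 -> 0 <= x < 1 ->
  k * (powR_sym p 1 (l * x) - 2) <= l ^+ 2 * (k * (powR_sym p 1 x - 2)).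
Proof.
move=> /andP[p0 p2] kp /[dup] l01 /andP[l0 l1] /andP[x0 x1].
have i01 : 0 <= (1 : R) <= 1 by rewrite ler01 /=.
(* [G0] and its derivative [G1] vanish at 0, and [G2], the derivative of [G1],
   is nonnegative because (1 + x)^(p - 2) + (1 - x)^(p - 2) is nondecreasing. *)
pose G0 x :=
  k * (l ^+ 2 * (powR_sym p 1 (1 * x) - 2) - (powR_sym p 1 (l * x) - 2)).
pose G1 x := k * (p * (l ^+ 2 * powR_sym (p - 1) (-1) (1 * x)
   - l * powR_sym (p - 1) (-1) (l * x))).
pose G2 x := k * (p - 1) * (p * (l ^+ 2 * (powR_sym (p - 1 - 1) (- -1) (1 * x)
   - powR_sym (p - 1 - 1) (- -1) (l * x)))).
have D0 (z : R) : 0 <= z < 1 -> is_derive z 1 G0 (G1 z).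
  move=> z01; rewrite /G0.
  have h1 := is_derive_powR_sym p 1 i01 z01.
  have h2 := is_derive_powR_sym p 1 l01 z01.
  by apply: is_derive_eq; rewrite /GRing.scale/= /G1; ring.
have D1 (z : R) : 0 <= z < 1 -> is_derive z 1 G1 (G2 z).
  move=> z01; rewrite /G1.
  have h1 := is_derive_powR_sym (p - 1) (-1) i01 z01.
  have h2 := is_derive_powR_sym (p - 1) (-1) l01 z01.
  by apply: is_derive_eq; rewrite /GRing.scale/= /G2; ring.
have G20 (z : R) : 0 <= z < 1 -> 0 <= G2 z.
  move=> /andP[z0 z1]; rewrite /G2; apply: mulr_ge0 => //.
  apply: mulr_ge0; first exact: ltW.
  apply: mulr_ge0; first exact: sqr_ge0.
  rewrite subr_ge0 opprK mul1r; apply: powR_sym_homo => //; first by lra.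
    exact: mulr_ge0.
  exact: ler_piMl.
have G10 (z : R) : 0 <= z < 1 -> 0 <= G1 z.
  move=> /andP[z0 z1]; have := is_derive_ge0_homo D1 G20 (lexx 0) z0 z1.
  suff -> : G1 0 = 0 by [].
  by rewrite /G1 !mulr0 powR_sym0 subrr !mulr0 subrr !mulr0.
have := is_derive_ge0_homo D0 G10 (lexx 0) x0 x1.
suff -> : G0 0 = 0 by rewrite /G0 mul1r => ?; nra.
by rewrite /G0 !mulr0 powR_sym0 -[1 + 1]/2 !subrr !mulr0 subrr !mulr0.
Qed.

(** S(0) = 2 and S'(0) = 0, while k S'' is k (p - 1) p times a sum of two powers, hence
    nonnegative. *)
Lemma powR_sym_ge2 (R : realType) (p k x : R) :
  0 < p -> 0 <= k * (p - 1) -> 0 <= x < 1 ->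
  0 <= k * (powR_sym p 1 x - 2).
Proof.
move=> p0 kp /andP[x0 x1].
have i01 : 0 <= (1 : R) <= 1 by rewrite ler01 /=.
pose G0 x := k * (powR_sym p 1 (1 * x) - 2).
pose G1 x := k * (p * powR_sym (p - 1) (-1) (1 * x)).
pose G2 x := k * (p - 1) * (p * powR_sym (p - 1 - 1) (- -1) (1 * x)).
have D0 (z : R) : 0 <= z < 1 -> is_derive z 1 G0 (G1 z).
  move=> z01; rewrite /G0.
  have h1 := is_derive_powR_sym p 1 i01 z01.
  by apply: is_derive_eq; rewrite /GRing.scale/= /G1; ring.
have D1 (z : R) : 0 <= z < 1 -> is_derive z 1 G1 (G2 z).
  move=> z01; rewrite /G1.
  have h1 := is_derive_powR_sym (p - 1) (-1) i01 z01.
  by apply: is_derive_eq; rewrite /GRing.scale/= /G2; ring.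
have G20 (z : R) : 0 <= z < 1 -> 0 <= G2 z.
  move=> /andP[z0 z1]; rewrite /G2; apply: mulr_ge0 => //.
  apply: mulr_ge0; first exact: ltW.
  by rewrite /powR_sym opprK !mul1r addr_ge0 ?powR_ge0.
have G10 (z : R) : 0 <= z < 1 -> 0 <= G1 z.
  move=> /andP[z0 z1]; have := is_derive_ge0_homo D1 G20 (lexx 0) z0 z1.
  suff -> : G1 0 = 0 by [].
  by rewrite /G1 !mulr0 powR_sym0 subrr !mulr0.
have := is_derive_ge0_homo D0 G10 (lexx 0) x0 x1.
suff -> : G0 0 = 0 by rewrite /G0 mul1r.
by rewrite /G0 !mulr0 powR_sym0 -[1 + 1]/2 !subrr !mulr0.
Qed.

Lemma cvg_powR_affine (R : realType) (p y s : R) :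
  0 < y -> (y + s * d) `^ p @[d --> 0^'+] --> y `^ p.
Proof.
move=> y0.
have [/derivable1_diffP/differentiable_continuous h _] := is_derive1_powR p y0.
have c : y + s * d @[d --> 0^'+] --> y.
  rewrite -[X in _ --> X]addr0 -[X in _ --> _ + X](mulr0 s).
  apply: cvgD; first exact: cvg_cst.
  apply: cvgM; first exact: cvg_cst.
  by apply: cvg_within_filter; exact: cvg_id.
exact: (@cvg_comp _ _ _ _ (@powR R ^~ p) _ _ _ c h).
Qed.

Lemma powR_sym_quadratic_bound (R : realType) (p k x : R) :
  0 < p < 2 -> 0 <= k * (p - 1) -> 0 <= x <= 1 ->
  0 <= k * (powR_sym p 1 x - 2) <= x ^+ 2 * (k * (2 `^ p - 2)).
Proof.
move=> /[dup] p02 /andP[p0 p2] kp /andP[x0].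
have U (z : R) : 0 <= z < 1 ->
    k * (powR_sym p 1 z - 2) <= z ^+ 2 * (k * (2 `^ p - 2)).
  move=> /andP[z0 z1].
  (* The scaling inequality is taken with scale [z] and argument [1 - d], then [d] tends to 0 from
     the right. *)
  have c1 : powR_sym p 1 (z * (1 - d)) @[d --> 0^'+] --> powR_sym p 1 z.
    rewrite /powR_sym; apply: cvgD.
      under eq_fun do rewrite mulrBr mulr1 addrA -mulNr.
      by apply: cvg_powR_affine; lra.
    apply: cvgM; first exact: cvg_cst.
    under eq_fun do rewrite mulrBr mulr1 opprB addrC -addrA (addrC (- z)) addrC.
    by apply: cvg_powR_affine; lra.
  have c2 : powR_sym p 1 (1 - d) @[d --> 0^'+] --> 2 `^ p.
    rewrite /powR_sym -[X in _ --> X]addr0; apply: cvgD.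
      under eq_fun do rewrite addrA -mulN1r.
      by apply: cvg_powR_affine; lra.
    under eq_fun do rewrite mul1r opprB addrC subrK.
    exact: powR_cvg0.
  have {c1} L : k * (powR_sym p 1 (z * (1 - d)) - 2) @[d --> 0^'+] -->
      k * (powR_sym p 1 z - 2).
    by apply: cvgM; [exact: cvg_cst|apply: cvgB => //; exact: cvg_cst].
  have {c2} L' : z ^+ 2 * (k * (powR_sym p 1 (1 - d) - 2)) @[d --> 0^'+] -->
      z ^+ 2 * (k * (2 `^ p - 2)).
    apply: cvgM; [exact: cvg_cst|].
    by apply: cvgM; [exact: cvg_cst|apply: cvgB => //; exact: cvg_cst].
  apply: (ler_cvg_to L L').
  near=> d; apply: powR_sym_scale => //; first by rewrite z0 ltW.
  apply/andP; split.
    by rewrite subr_ge0; near: d; apply: nbhs_right_le.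
  by rewrite ltrBlDr ltrDl; near: d; apply: nbhs_right_gt.
rewrite le_eqVlt => /predU1P[->|x1]; last first.
  by rewrite powR_sym_ge2 ?U ?x0.
have -> : powR_sym p 1 1 = 2 `^ p.
  by rewrite /powR_sym subrr mul1r powR0 ?gt_eqF// addr0.
rewrite expr1n mul1r lexx andbT.
(* At x = 1 the lower bound says that k (2^p - 2) is nonnegative. This follows from the two bounds
   at any interior point other than 0, here 1/2. *)
have h2 : 0 <= (2^-1 : R) < 1 by apply/andP; split; lra.
have := le_trans (powR_sym_ge2 p0 kp h2) (U _ h2).
by rewrite pmulr_rge0// exprn_gt0 // invr_gt0.
Unshelve. all: by end_near. Qed.

(** * The cross term of the increment variance *)

(** With p = 2H and k = ab, this is what the increment variance subtracts from (a^2 + b^2) (t -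
    s)^p. *)
Definition cross_term (R : realType) (p k s t : R) : R :=
  k * (2 `^ p * (t `^ p + s `^ p) - 2 * (t + s) `^ p).

(** The substitution is u = t + s, x = (t - s) / (t + s). The factor 2^p absorbs the halves, and u^p
    comes out by homogeneity. *)
Lemma cross_termE (R : realType) (p k u x : R) :
  0 <= u -> 0 <= x <= 1 ->
  cross_term p k (u * (1 - x) / 2) (u * (1 + x) / 2) =
  u `^ p * (k * (powR_sym p 1 x - 2)).
Proof.
move=> u0 /andP[x0 x1]; rewrite /cross_term.
have -> : u * (1 + x) / 2 + u * (1 - x) / 2 = u by field.
have h1 : 0 <= 1 + x by lra.
have h2 : 0 <= 1 - x by lra.
rewrite [2 `^ p * _]mulrDr -!powRM ?divr_ge0 ?mulr_ge0//.
rewrite ![2 * (_ / _)]mulrC !divfK// !powRM//.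
by rewrite /powR_sym; ring.
Qed.

Lemma cross_term_bounds (R : realType) (p k s t : R) :
  0 < p < 2 -> 0 <= k * (p - 1) -> 0 <= s -> s <= t ->
  0 <= cross_term p k s t <= k * (2 `^ p - 2) * (t - s) `^ p.
Proof.
move=> /[dup] p02 /andP[p0 p2] kp s0 st.
(* The ratio x is meaningful only for t + s > 0; otherwise s = t = 0 and everything vanishes, since
   0^p = 0. *)
have [u0|u0] := eqVneq (t + s) 0.
  have -> : s = 0 by lra.
  have -> : t = 0 by lra.
  rewrite /cross_term subrr !addr0 powR0 ?gt_eqF// addr0.
  by rewrite !mulr0 subrr mulr0 lexx.
have {}u0 : 0 < t + s by rewrite lt_def u0 addr_ge0// (le_trans s0).
pose x := (t - s) / (t + s).
have x0 : 0 <= x by rewrite divr_ge0 ?subr_ge0// ltW.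
have x1 : x <= 1 by rewrite ler_pdivrMr//; lra.
have x01 : 0 <= x <= 1 by rewrite x0.
have -> : cross_term p k s t = (t + s) `^ p * (k * (powR_sym p 1 x - 2)).
  rewrite -cross_termE ?(ltW u0)//.
  have -> : (t + s) * (1 - x) / 2 = s by rewrite /x; field; rewrite gt_eqF.
  by have -> : (t + s) * (1 + x) / 2 = t by rewrite /x; field; rewrite gt_eqF.
have -> : t - s = (t + s) * x by rewrite mulrC divfK// gt_eqF.
have /andP[l r] := powR_sym_quadratic_bound p02 kp x01.
rewrite mulr_ge0 ?powR_ge0//= powRM// ?(ltW u0)//.
rewrite [leRHS]mulrCA ler_pM2l ?powR_gt0//.
(* The estimate at x = 1 shows that k (2^p - 2) is nonnegative, so x^2 <= x^p remains; it holds
   because x <= 1 and p < 2. *)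
apply: (le_trans r); rewrite mulrC; apply: ler_wpM2l.
  have h1 : 0 <= (1 : R) <= 1 by rewrite ler01 /=.
  have /andP[a b] := powR_sym_quadratic_bound p02 kp h1.
  by move: (le_trans a b); rewrite expr1n mul1r.
have [->|xn0] := eqVneq x 0; first by rewrite expr0n powR_ge0.
rewrite -powR_mulrn//; apply: ger_powR; last exact: ltW.
by rewrite lt_def xn0 x0.
Qed.

Lemma cross_term01 (R : realType) (p k : R) : p != 0 ->
  cross_term p k 0 1 = k * (2 `^ p - 2).
Proof. by move=> p0; rewrite /cross_term powR0// !addr0 powR1 !mulr1. Qed.

(** Along t + s = 1 and t - s = x the cross term is at most x^2 k (2^p - 2). Dividing by x^p bounds
    [c] by a multiple of x^(2 - p), which tends to 0 with x. *)
Lemma le_cross_term_le0 (R : realType) (p k c : R) :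
  0 < p < 2 -> 0 <= k * (p - 1) ->
  (forall s t, 0 <= s -> s <= t -> c * (t - s) `^ p <= cross_term p k s t) ->
  c <= 0.
Proof.
move=> /[dup] p02 /andP[p0 p2] kp hc.
have U (x : R) : 0 < x < 1 -> c <= x `^ (2 - p) * (k * (2 `^ p - 2)).
  move=> /andP[x0 x1].
  have x01 : 0 <= x <= 1 by rewrite !ltW.
  have /andP[_] := powR_sym_quadratic_bound p02 kp x01.
  have -> : k * (powR_sym p 1 x - 2) =
      cross_term p k (1 * (1 - x) / 2) (1 * (1 + x) / 2).
    by rewrite cross_termE// powR1 mul1r.
  have /hc : 0 <= 1 * (1 - x) / 2 by lra.
  have le : 1 * (1 - x) / 2 <= 1 * (1 + x) / 2 by lra.
  move=> /(_ _ le) h /(le_trans h).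
  have -> : 1 * (1 + x) / 2 - 1 * (1 - x) / 2 = x by field.
  rewrite -powR_mulrn ?(ltW x0)// powRB; last by rewrite gt_eqF// implybT.
  by rewrite mulrAC ler_pdivlMr ?powR_gt0.
have L : x `^ (2 - p) * (k * (2 `^ p - 2)) @[x --> 0^'+] --> 0.
  rewrite -[X in _ --> X](mul0r (k * (2 `^ p - 2))).
  apply: cvgM; last exact: cvg_cst.
  by apply: powR_cvg0; lra.
apply: (cvgr_to_ge L); near=> x; apply: U; apply/andP; split.
- by near: x; apply: nbhs_right_gt.
- by near: x; apply: nbhs_right_lt.
Unshelve. all: by end_near. Qed.

(** * Second moments of the process *)

(** For a centered variable, the covariance with itself is the integral of X^2. The covariance
    formula of the fBm thus supplies the integrability that bilinearity of covariance requires. *)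
Lemma centered_Lfun2 d (T : measurableType d) (R : realType)
    (P : probability T R) (X : {RV P >-> R}) :
  'E_P[X]%E = 0%E -> covariance P X X \is a fin_num ->
  (X : T -> R) \in Lfun P 2%:E.
Proof.
move=> EX; rewrite covariance.unlock EX expectation.unlock /= => fX.
rewrite inE; apply/andP; split; rewrite inE//=.
rewrite /finite_norm unlock; apply: poweR_lty.
rewrite (_ : (\int[_]_x _)%E =
   (\int[P]_x (((X \- cst 0) * (X \- cst 0)) x)%:E)%E).
  by rewrite ltey_eq fX.
apply: eq_integral => x _.
by rewrite mulrfctE /= !subr0 -expr2 powR_mulrn// real_normK// num_real.
Qed.

Lemma covarianceZl_Lfun2 d (T : measurableType d) (R : realType)
    (P : probability T R) (a : R) (X Y : T -> R) :
  X \in Lfun P 2%:E -> Y \in Lfun P 2%:E ->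
  covariance P (a \o* X) Y = (a%:E * covariance P X Y)%E.
Proof.
move=> X2 Y2.
have Pfin : P setT \is a fin_num := fin_num_measure P _ measurableT.
by rewrite covarianceZl ?Lfun2_mul_Lfun1 ?(Lfun_subset12 Pfin).
Qed.

Lemma gfBm_increment d (T : measurableType d) (R : realType)
    (P : probability T R) (H a b : R) (B : R -> {RV P >-> R}) (s t : R) :
  0 < H -> two_sided_fBm H B -> 0 <= s -> s <= t ->
  'E_P[fun w => ((gfBm a b B t w - gfBm a b B s w) ^+ 2)%R]%E =
  ((a ^+ 2 + b ^+ 2) * (t - s) `^ (2 * H) - cross_term (2 * H) (a * b) s t)%:E.
Proof.
move=> H0 [_ EB covB] s0 st.
have t0 := le_trans s0 st.
have Pfin : P setT \is a fin_num := fin_num_measure P _ measurableT.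
have B2 r : (B r : T -> R) \in Lfun P 2%:E.
  by apply: centered_Lfun2; [exact: EB|rewrite covB].
have B1 r : (B r : T -> R) \in Lfun P 1 by apply: (Lfun_subset12 Pfin).
have BZ c r : (c \o* (B r : T -> R)) \in Lfun P 2%:E.
  by apply: Lfun_scale => //; rewrite ler1n.
have BZ1 c r : (c \o* (B r : T -> R)) \in Lfun P 1.
  by apply: (Lfun_subset12 Pfin).
(* This is [gfBm] in the form expected by the expectation lemmas; [\o*] multiplies on the right,
   hence the later use of [mulrC]. *)
pose Z r : T -> R := a \o* (B r : T -> R) \+ b \o* (B (- r) : T -> R).
have Z2 r : Z r \in Lfun P 2%:E by rewrite rpredD ?lee1n//=.
have Z1 r : Z r \in Lfun P 1 by apply: (Lfun_subset12 Pfin).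
have EZ r : 'E_P[Z r]%E = 0%E.
  by rewrite /Z expectationD// !expectationZl// !EB !mule0 adde0.
(* Since the increment is centered, its second moment is its variance. *)
have -> : 'E_P[fun w => ((gfBm a b B t w - gfBm a b B s w) ^+ 2)%R]%E
   = variance P (Z t \- Z s).
  rewrite varianceE; last by rewrite rpredB ?lee1n.
  rewrite expectationB// !EZ.
  rewrite sube0 expe2 mule0 sube0; congr expectation; apply/funext => w.
  by rewrite exprfctE /Z /= !(mulrC (B _ _)).
have covZ u v : covariance P (Z u) (Z v) =
    ((a ^+ 2 + b ^+ 2) *
       (2^-1 * (`|u| `^ (2 * H) + `|v| `^ (2 * H) - `|u - v| `^ (2 * H)))
     + a * b * (`|u| `^ (2 * H) + `|v| `^ (2 * H) - `|u + v| `^ (2 * H)))%:E.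
  have covr X r r' : X \in Lfun P 2%:E ->
      covariance P X (a \o* (B r : T -> R) \+ b \o* (B r' : T -> R)) =
      (a%:E * covariance P X (B r) + b%:E * covariance P X (B r'))%E.
    by move=> X2; rewrite covarianceDr// !(covarianceC P X) !covarianceZl_Lfun2.
  rewrite {1}/Z covarianceDl// !covarianceZl_Lfun2// !covr// !covB.
  have e1 : `|- u - v| = `|u + v| by rewrite -opprD normrN.
  have e2 : `|- u - - v| = `|u - v| by rewrite -opprD normrN.
  rewrite e1 e2 !normrN !opprK -!(EFinM, EFinD).
  by congr EFin; field.
rewrite varianceB// /variance !covZ -EFinM -!EFinD; congr EFin.
rewrite /cross_term !subrr normr0 powR0; last by rewrite mulf_neq0// gt_eqF.
(* On the diagonal the term |u + v|^p becomes (2u)^p, the source of the factor 2^p in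
   [cross_term]. *)
have dbl r : 0 <= r -> `|r + r| `^ (2 * H) = 2 `^ (2 * H) * r `^ (2 * H).
  move=> r0; rewrite ger0_norm ?addr_ge0// -powRM ?ler0n//.
  by rewrite (mulr_natl r) mulr2n.
rewrite !dbl// !ger0_norm ?subr_ge0 ?addr_ge0//.
by field.
Qed.

(** * Optimal constants and their indicator formulas *)

Lemma best_incr_bounds_cross_term d (T : measurableType d) (R : realType)
    (P : probability T R) (H A k : R) (Z : R -> {RV P >-> R}) :
  0 < H < 1 ->
  (forall s t, 0 <= s -> s <= t ->
    'E_P[fun w => ((Z t w - Z s w) ^+ 2)%R]%E =
    (A * (t - s) `^ (2 * H) - cross_term (2 * H) k s t)%:E) ->
  (0 <= k * (2 * H - 1) ->
    best_incr_bounds Z H (A - k * (2 `^ (2 * H) - 2)) A) /\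
  (k * (2 * H - 1) <= 0 ->
    best_incr_bounds Z H A (A - k * (2 `^ (2 * H) - 2))).
Proof.
move=> /andP[H0 H1] EZ.
have p02 : 0 < 2 * H < 2 by lra.
have p0 : 2 * H != 0 by rewrite gt_eqF//; lra.
have at01 c : (c * (1 - 0) `^ (2 * H))%:E = c%:E :> \bar R.
  by rewrite subr0 powR1 mulr1.
have E01 := EZ 0 1 (lexx 0) ler01.
rewrite subr0 powR1 mulr1 cross_term01// in E01.
(* Linearity in [k] reduces the second case to the first one for [- k]. *)
have negE s t : cross_term (2 * H) k s t = - cross_term (2 * H) (- k) s t.
  by rewrite /cross_term mulNr opprK.
split=> hk.
  have B s t := cross_term_bounds (s := s) (t := t) p02 hk.
  split.
  - by move=> s t s0 st; rewrite EZ// lee_fin; have := B s t s0 st; lra.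
  - by move=> s t s0 st; rewrite EZ// lee_fin; have := B s t s0 st; lra.
  - by move=> c /(_ 0 1 (lexx 0) ler01); rewrite at01 E01 lee_fin.
  (* An upper constant [c] for the variance makes A - c a lower constant for the cross term, so A -
     c <= 0. *)
  - move=> c hc; rewrite -subr_le0.
    apply: (le_cross_term_le0 p02 hk) => s t s0 st.
    by have := hc s t s0 st; rewrite EZ// lee_fin; lra.
have {}hk : 0 <= - k * (2 * H - 1) by lra.
have B s t := cross_term_bounds (s := s) (t := t) p02 hk.
split.
- by move=> s t s0 st; rewrite EZ// lee_fin negE; have := B s t s0 st; lra.
- by move=> s t s0 st; rewrite EZ// lee_fin negE; have := B s t s0 st; lra.
- move=> c hc; rewrite -subr_le0.
  apply: (le_cross_term_le0 p02 hk) => s t s0 st.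
  by have := hc s t s0 st; rewrite EZ// lee_fin negE; lra.
- by move=> c /(_ 0 1 (lexx 0) ler01); rewrite at01 E01 lee_fin.
Qed.

(** A strict sign rules out H = 1/2 and ab = 0, so exactly one of the two sets contains the
    triple. *)
Lemma indic_setC_setD_gfBm (R : realType) (a b H : R) :
  0 < H < 1 -> (a, b) != (0, 0) ->
  (0 < a * b * (2 * H - 1) ->
    \1_(@setC_gfBm R) (a, b, H) = 1 :> R /\
    \1_(@setD_gfBm R) (a, b, H) = 0 :> R) /\
  (a * b * (2 * H - 1) < 0 ->
    \1_(@setC_gfBm R) (a, b, H) = 0 :> R /\
    \1_(@setD_gfBm R) (a, b, H) = 1 :> R).
Proof.
move=> hH hab; split=> hk; rewrite !indicE.
- rewrite mem_set ?memNset//=.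
    by case=> _ _ [] []; nra.
  split=> //; case: (ltgtP H 2^-1) => hH2; [right|left|]; last by exfalso; nra.
  + by split=> //; nra.
  + by split=> //; nra.
- rewrite memNset ?mem_set//=.
    split=> //.
    case: (ltgtP H 2^-1) => hH2; [right|left|]; last by exfalso; nra.
    + by split=> //; nra.
    + by split=> //; nra.
  by case=> _ _ [] []; nra.
Qed.

Lemma gamma_nu_gfBm (R : realType) (a b H : R) :
  0 < H < 1 -> (a, b) != (0, 0) ->
  let A := a ^+ 2 + b ^+ 2 in let K := a * b * (2 `^ (2 * H) - 2) in
  (0 < a * b * (2 * H - 1) -> gamma_gfBm a b H = A - K /\ nu_gfBm a b H = A) /\
  (a * b * (2 * H - 1) < 0 -> gamma_gfBm a b H = A /\ nu_gfBm a b H = A - K).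
Proof.
move=> hH hab A K; have [pos neg] := indic_setC_setD_gfBm hH hab.
(* Factoring 2 out of 2^(2H) - 2 reconciles the constant found above with the one in the indicator
   formulas. *)
have K2 : K = 2 * a * b * (2 `^ (2 * H - 1) - 1).
  rewrite /K -(@mulr_powRB1 _ 2 (2 * H)) ?ler0n//; first by ring.
  by case/andP: hH; lra.
by split=> hk; [have [i1 i2] := pos hk|have [i1 i2] := neg hk];
  rewrite /gamma_gfBm /nu_gfBm i1 i2 K2 /A; split; ring.
Qed.

Theorem lemma3 (d : measure_display) (T : measurableType d) (R : realType)
    (P : probability T R) (H a b : R) (B : R -> {RV P >-> R})
    (hH : 0 < H < 1) (hab : (a, b) != (0, 0)) (hB : two_sided_fBm H B) :
  [/\ forall s t : R, 0 <= s -> s <= t ->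
        'E_P[fun w => ((gfBm a b B t w - gfBm a b B s w) ^+ 2)%R]%E =
        ((a ^+ 2 + b ^+ 2) * `|t - s| `^ (2 * H)
         - 2 `^ (2 * H) * a * b * (`|t| `^ (2 * H) + `|s| `^ (2 * H))
         + 2 * a * b * `|t + s| `^ (2 * H))%:E,
      H != 2^-1 -> a * b != 0 ->
        best_incr_bounds (gfBm a b B) H (gamma_gfBm a b H) (nu_gfBm a b H)
    & H = 2^-1 \/ a * b = 0 ->
        best_incr_bounds (gfBm a b B) H (a ^+ 2 + b ^+ 2) (a ^+ 2 + b ^+ 2)].
Proof.
have /andP[H0 H1] := hH.
have E s t := gfBm_increment (s := s) (t := t) a b H0 hB.
have [lo up] := best_incr_bounds_cross_term hH E.
split.
- move=> s t s0 st.
  rewrite E// !ger0_norm ?subr_ge0 ?addr_ge0 ?(le_trans s0 st)//.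
  by congr EFin; rewrite /cross_term; ring.
- move=> hn0 ab0; have [gpos gneg] := gamma_nu_gfBm hH hab.
  have k0 : a * b * (2 * H - 1) != 0.
    by rewrite mulf_neq0// subr_eq0; apply: contra_neq hn0; lra.
  case: (ltgtP (a * b * (2 * H - 1)) 0) k0 => // hk _.
    by have [-> ->] := gneg hk; apply/up/ltW.
  by have [-> ->] := gpos hk; apply/lo/ltW.
(* Here k (p - 1) and k (2^p - 2) both vanish, so the two constants coincide. *)
- move=> h; have k0 : a * b * (2 * H - 1) = 0.
    by case: h => [->|->]; [field|rewrite mul0r].
  have K0 : a * b * (2 `^ (2 * H) - 2) = 0.
    case: h => [->|->]; last by rewrite mul0r.
    by rewrite divff// powRr1// subrr mulr0.
  by move: lo; rewrite k0 K0 subr0; apply.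
Qed.
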